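(* Let $n_1,\ldots,n_r,r,s$ be positive integers with $3\leq n_1\leq\cdots\leq n_r$ and $r>s$. If $\left\lfloor\frac{rn_1-r}{s}\right\rfloor\leq\binom{r}{s}$, then $$\left\lfloor\frac{rn_1-r}{s}\right\rfloor+1\leq \mathrm{R}_{r,s}(K_{1,n_1},\ldots,K_{1,n_r})\leq \left\lceil\frac{\sum_{i=1}^{r}n_i-r+1}{s}\right\rceil+1.$$ Moreover, the upper bound is sharp.
   Context: $K_{1,n}$ denotes the star with one center and $n$ leaves. For positive integers $r\ge s$ and graphs $G_1,\dots,G_r$, the set-coloring Ramsey number $\mathrm{R}_{r,s}(G_1,\dots,G_r)$ is the least $N\in\mathbb{N}$ such that for every coloring $\chi:E(K_N)\to\binom{[r]}{s}$ (each edge receives a set of $s$ distinct colors from $[r]$) there exist $i\in[r]$ and a copy of $G_i$ in $K_N$ with $i\in\chi(e)$ for every edge $e$ of this copy. *)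

(* Defs.v *)
From mathcomp Require Import all_boot.

Set Implicit Arguments.
Unset Strict Implicit.
Unset Printing Implicit Defensive.

Record sgraph := SGraph {
  vertex : finType;
  adj : rel vertex;
  adj_sym : symmetric adj;
  adj_irrefl : irreflexive adj }.

(* The center of K_{1,n} is ord0: two vertices are adjacent iff exactly one of
   them is the center. *)
Definition star_adj (n : nat) : rel 'I_n.+1 :=
  fun x y => (x == ord0) != (y == ord0).

Lemma star_adj_sym n : symmetric (@star_adj n).
Proof. by move=> x y; rewrite /star_adj eq_sym. Qed.

Lemma star_adj_irrefl n : irreflexive (@star_adj n).
Proof. by move=> x; rewrite /star_adj eqxx. Qed.

Definition star (n : nat) : sgraph :=
  SGraph (@star_adj_sym n) (@star_adj_irrefl n).

(* K_N has vertex set 'I_N and its edges are the two-element subsets of 'I_N;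
   the values of chi on other subsets are irrelevant. *)
Definition set_coloring (r s N : nat) (chi : {set 'I_N} -> {set 'I_r}) : Prop :=
  forall e : {set 'I_N}, #|e| = 2 -> #|chi e| = s.

Definition has_copy_in_color (r N : nat) (chi : {set 'I_N} -> {set 'I_r})
    (i : 'I_r) (G : sgraph) : Prop :=
  exists f : vertex G -> 'I_N,
    injective f /\ forall u v, adj u v -> i \in chi [set f u; f v].

Definition set_arrows (r s : nat) (G : 'I_r -> sgraph) (N : nat) : Prop :=
  forall chi : {set 'I_N} -> {set 'I_r}, set_coloring s chi ->
    exists i : 'I_r, has_copy_in_color chi i (G i).

(* R_{r,s}(G_1, ..., G_r) = N; the colors 1, ..., r are indexed by 'I_r. *)
Definition is_set_ramsey (r s : nat) (G : 'I_r -> sgraph) (N : nat) : Prop :=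
  set_arrows s G N /\ forall M, set_arrows s G M -> N <= M.

Lemma is_set_ramsey_unique r s (G : 'I_r -> sgraph) N1 N2 :
  is_set_ramsey s G N1 -> is_set_ramsey s G N2 -> N1 = N2.
Proof.
move=> [a1 m1] [a2 m2]; apply/eqP.
by rewrite eqn_leq (m1 _ a2) (m2 _ a1).
Qed.

Definition ceil_divn (m d : nat) : nat := (m + d.-1) %/ d.

Lemma ceil_divn_leq m d k : 0 < d -> (ceil_divn m d <= k) = (m <= k * d).
Proof.
case: d => // d _; rewrite /ceil_divn -ltnS ltn_divLR //= mulSn.
by rewrite addSn ltnS addnC leq_add2l.
Qed.

(* Main.v *)
Require Import Defs.
From mathcomp Require Import all_boot.
From Stdlib Require Import Classical.

(** Upper bound: a vertex of [K_N] lies on [N - 1] edges, carrying [s (N - 1)]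
    colors with multiplicity, so by pigeonhole some color [i] occurs [n_i] times.

    Lower bound: take a proper edge coloring of [K_N] by [m] classes, read the
    residues [0, 1, ..., m s - 1] mod [r] consecutively, and give the edges of
    class [k] the [s] residues [k s, ..., k s + s - 1].  If [m s <= r d], each
    color is used by at most [d] classes, hence at most [d] times at each vertex.
    With [m = N] classes ([x + y] mod [N]) this gives the lower bound; the
    [1]-factorization of [K_4] into [3] classes, with [r = 3], [s = 2] and
    [n_i = 3], gives sharpness. *)

Set Implicit Arguments.
Unset Strict Implicit.
Unset Printing Implicit Defensive.

(** Classical descent, since [P] need not be decidable; it turns an arrowing bound into the
    existence of the Ramsey number. *)
Lemma ex_least (P : nat -> Prop) (n : nat) :
  P n -> exists m, [/\ P m, m <= n & forall k, P k -> m <= k].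
Proof.
elim/ltn_ind: n => n IH Pn.
case: (classic (exists2 k, k < n & P k)) => [[k lt_kn Pk]|nP].
  have [m [Pm le_mk minm]] := IH k lt_kn Pk.
  by exists m; split=> //; apply: leq_trans le_mk (ltnW lt_kn).
exists n; split=> // k Pk; rewrite leqNgt; apply/negP => lt_kn.
by apply: nP; exists k.
Qed.

Lemma star_copy (r N : nat) (chi : {set 'I_N} -> {set 'I_r}) (i : 'I_r)
    (n : nat) (v : 'I_N) :
  n <= #|[set w | (w != v) && (i \in chi [set v; w])]| ->
  has_copy_in_color chi i (star n).
Proof.
set A := [set w | _] => le_nA.
pose leaf (j : 'I_n) : 'I_N := enum_val (widen_ord le_nA j).
have leafP j : (leaf j != v) && (i \in chi [set v; leaf j]).
  by have := enum_valP (widen_ord le_nA j); rewrite inE.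
have leaf_inj : injective leaf.
  by move=> j k /enum_val_inj /(congr1 val) /= ejk; apply: val_inj.
exists (fun x : 'I_n.+1 => if unlift ord0 x is Some j then leaf j else v).
split=> [x y|x y] /=.
  case: unliftP => [j ->|->]; case: unliftP => [k ->|->] //.
  - by move/leaf_inj->.
  - by move=> e; have := leafP j; rewrite e eqxx.
  - by move=> e; have := leafP k; rewrite -e eqxx.
rewrite /star_adj; case: unliftP => [j ->|->]; case: unliftP => [k ->|->] //=.
- by move=> _; rewrite setUC; case/andP: (leafP j).
- by move=> _; case/andP: (leafP k).
Qed.

Lemma star_arrows (r s k : nat) (n : 'I_r -> nat) :
  (forall i, 0 < n i) -> \sum_(i < r) n i - r < k * s ->
  set_arrows s (fun i => star (n i)) k.+1.
Proof.
move=> n_gt0 lt_sum chi chiP.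
pose A i := [set w : 'I_k.+1 | (w != ord0) && (i \in chi [set ord0; w])].
case: (boolP [exists i, n i <= #|A i|]) => [/existsP[i le_nA]|].
  by exists i; apply: star_copy le_nA.
rewrite negb_exists => /forallP ltA.
(* Double counting at [ord0]: each of its [k] edges contributes its [s] colors. *)
have sumA : \sum_(i < r) #|A i| = k * s.
  transitivity (\sum_(i < r) \sum_(w | w != ord0) (i \in chi [set ord0; w])).
    apply: eq_bigr => i _; rewrite -sum1_card big_mkcond [RHS]big_mkcond /=.
    by apply: eq_bigr => w _; rewrite inE; case: (w != ord0) => //=; case: ifP.
  rewrite exchange_big /= (eq_bigr (fun=> s)) => [|w w_neq0].
    by rewrite sum_nat_const cardC1 card_ord.
  rewrite -(chiP [set ord0; w]); last by rewrite cards2 eq_sym w_neq0.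
  by rewrite -sum1_card [RHS]big_mkcond; apply: eq_bigr => i _; case: ifP.
have : \sum_(i < r) (#|A i| + 1) <= \sum_(i < r) n i.
  by apply: leq_sum => i _; rewrite addn1 ltnNge.
rewrite big_split /= sumA sum1_card card_ord => /(leq_sub2r r).
by rewrite addnK leqNgt lt_sum.
Qed.

Section CyclicPalette.

Variables (r s : nat) (r_gt0 : 0 < r).

Definition palette (k : nat) : {set 'I_r} :=
  [set Ordinal (ltn_pmod (k * s + t) r_gt0) | t : 'I_s].

Lemma card_palette k : s <= r -> #|palette k| = s.
Proof.
move=> le_sr; rewrite card_imset ?card_ord // => t u [] /eqP.
by rewrite eqn_modDl !modn_small ?(leq_trans _ le_sr) // => /eqP/val_inj.
Qed.

(** Each leaf gives a position [c j * s + t j] below [m * s <= r * d] that is congruent to [i] mod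
    [r]. Only [d] such positions exist, and distinct leaves have distinct ones. *)
Lemma palette_no_star (N m d n : nat) (phi : {set 'I_N} -> nat) (i : 'I_r) :
  (forall e, phi e < m) ->
  (forall u v w, u != v -> u != w ->
     phi [set u; v] = phi [set u; w] -> v = w) ->
  m * s <= r * d -> d < n ->
  ~ has_copy_in_color (fun e => palette (phi e)) i (star n).
Proof.
move=> phi_lt phi_proper le_ms lt_dn [f [f_inj fP]].
pose c (j : 'I_n) := phi [set f ord0; f (lift ord0 j)].
have /fin_all_exists[t tP] :
    forall j, exists t : 'I_s, (c j * s + t) %% r = i :> nat.
  move=> j; have /imsetP[t _ ->] : i \in palette (c j) by apply: fP.
  by exists t.
have q_lt j : (c j * s + t j) %/ r < d.
  rewrite ltn_divLR // [d * r]mulnC; apply: leq_trans le_ms.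
  have := phi_lt [set f ord0; f (lift ord0 j)]; rewrite -/(c j) => lt_cm.
  apply: (@leq_trans ((c j).+1 * s)); last by rewrite leq_mul2r lt_cm orbT.
  by rewrite mulSn addnC ltn_add2r.
have q_inj : injective (fun j => Ordinal (q_lt j)).
  move=> j k [] eq_q.
  have e : c j * s + t j = c k * s + t k.
    by rewrite (divn_eq (c j * s + t j) r) (divn_eq (c k * s + t k) r) eq_q !tP.
  have s_gt0 : 0 < s by apply: leq_trans (ltn_ord (t j)).
  (* As [t j < s], dividing the position by [s] recovers the class; properness at the center then
     recovers the leaf. *)
  have := congr1 (divn^~ s) e; rewrite !divnMDl // !divn_small // !addn0.
  have neq0 l : f ord0 != f (lift ord0 l) by rewrite (inj_eq f_inj) neq_lift.
  by move/(phi_proper _ _ _ (neq0 j) (neq0 k))/f_inj/lift_inj.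
by have := leq_card _ q_inj; rewrite !card_ord leqNgt lt_dn.
Qed.

End CyclicPalette.

Lemma proper_coloring_not_arrows (r s N m d : nat) (n : 'I_r -> nat)
    (phi : {set 'I_N} -> nat) :
  0 < r -> s <= r -> (forall e, phi e < m) ->
  (forall u v w, u != v -> u != w ->
     phi [set u; v] = phi [set u; w] -> v = w) ->
  m * s <= r * d -> (forall i, d < n i) ->
  ~ set_arrows s (fun i => star (n i)) N.
Proof.
move=> r_gt0 le_sr phi_lt phi_proper le_ms lt_dn arr.
have [e _|i] := arr (fun e => palette s r_gt0 (phi e)).
  exact: card_palette.
exact: palette_no_star phi_lt phi_proper le_ms (lt_dn i).
Qed.

Lemma sum_set2 (N : nat) (u v : 'I_N) :
  u != v -> \sum_(x in [set u; v]) (x : nat) = u + v.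
Proof. by move=> neq_uv; rewrite big_setU1 ?inE //= big_set1. Qed.

Lemma stars_not_arrows (r s N d : nat) (n : 'I_r -> nat) :
  0 < r -> s <= r -> N * s <= r * d -> (forall i, d < n i) ->
  ~ set_arrows s (fun i => star (n i)) N.
Proof.
move=> r_gt0 le_sr le_Ns lt_dn arr.
(* Reduction mod [N] is bounded by [N] only for positive [N]; for [N = 0] there is no vertex to
   serve as a center. *)
have N_gt0 : 0 < N.
  case: N le_Ns arr => // _ /(_ (fun=> palette s r_gt0 0))[e _|i [f _]].
    exact: card_palette.
  by case: (f ord0).
pose phi (e : {set 'I_N}) := (\sum_(x in e) (x : nat)) %% N.
apply: (@proper_coloring_not_arrows r s N N d n phi) => // [e|u v w uv uw].
  exact: ltn_pmod.
rewrite /phi !sum_set2 // => /eqP.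
by rewrite eqn_modDl !modn_small // => /eqP/val_inj.
Qed.

(* The perfect matchings of [K_4] are the level sets of [|x + y - 3|]. *)
Lemma K4_not_arrows : ~ @set_arrows 3 2 (fun=> star 3) 4.
Proof.
pose dist3 a := (a - 3) + (3 - a).
(* Edge sums run from 1 to 5, so the cap at 2 leaves edges unchanged; it bounds [phi] on the other
   subsets. *)
pose phi (e : {set 'I_4}) := minn 2 (dist3 (\sum_(x in e) (x : nat))).
apply: (@proper_coloring_not_arrows 3 2 4 3 2 (fun=> 3) phi) => // [e|u v w].
  by rewrite ltnS geq_minl.
move=> uv uw; rewrite /phi !sum_set2 // /dist3 => /eqP eq_phi; apply: val_inj.
move: uv uw eq_phi; rewrite -!val_eqE /=.
by case: u v w => [[|[|[|[|u]]]] ?] [[|[|[|[|v]]]] ?] [[|[|[|[|w]]]] ?].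
Qed.

Theorem theorem2p9 :
  (forall (r s : nat) (hr : 0 < r) (n : 'I_r -> nat),
     0 < s -> s < r ->
     3 <= n (Ordinal hr) ->
     (forall i j : 'I_r, i <= j -> n i <= n j) ->
     (r * n (Ordinal hr) - r) %/ s <= 'C(r, s) ->
     exists N : nat,
       is_set_ramsey s (fun i => star (n i)) N /\
       (r * n (Ordinal hr) - r) %/ s + 1 <= N
         <= ceil_divn (\sum_(i < r) n i - r + 1) s + 1)
  /\
  (exists (r s : nat) (hr : 0 < r) (n : 'I_r -> nat),
     [/\ 0 < s, s < r,
         3 <= n (Ordinal hr),
         (forall i j : 'I_r, i <= j -> n i <= n j) &
         (r * n (Ordinal hr) - r) %/ s <= 'C(r, s)] /\
     is_set_ramsey s (fun i => star (n i))
       (ceil_divn (\sum_(i < r) n i - r + 1) s + 1)).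
Proof.
split=> [r s hr n s_gt0 lt_sr n0_ge3 n_mono _|].
  have n0_le i : n (Ordinal hr) <= n i by apply: n_mono.
  have n_gt0 i : 0 < n i by apply: leq_trans (n0_le i); apply: leq_trans n0_ge3.
  set U := ceil_divn _ _.
  have arrU : set_arrows s (fun i => star (n i)) (U + 1).
    rewrite addn1; apply: star_arrows => //.
    by have := leqnn U; rewrite {1}/U ceil_divn_leq // addn1.
  have [N [arrN le_NU minN]] := ex_least arrU.
  exists N; split; first by split.
  rewrite le_NU andbT addn1 ltnNge; apply/negP; rewrite leq_divRL // => le_Ns.
  (* The choice [d = n_1 - 1] makes [r * d] equal to the numerator [r * n_1 - r]. *)
  apply: (@stars_not_arrows r s N (n (Ordinal hr)).-1 n) arrN => //.
  - exact: ltnW.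
  - by apply: leq_trans le_Ns _; rewrite -subn1 mulnBr muln1.
  - by move=> i; apply: leq_trans (n0_le i); rewrite prednK.
exists 3, 2, isT, (fun=> 3); split=> //.
have -> : ceil_divn (\sum_(i < 3) 3 - 3 + 1) 2 + 1 = 5.
  by rewrite sum_nat_const card_ord.
split=> [|M arrM]; first by apply: star_arrows; rewrite // sum_nat_const card_ord.
(* With [d = 2] the cyclic coloring needs [M * 2 <= 6], so it covers [M <= 3]; [M = 4] requires the
   three matchings. *)
rewrite leqNgt; apply/negP; rewrite ltnS leq_eqVlt => /orP[/eqP eM|lt_M4].
  by apply: K4_not_arrows; rewrite -eM.
apply: (@stars_not_arrows 3 2 M 2 (fun=> 3)) arrM => //.
by rewrite (@leq_mul2r 2 M 3).
Qed.
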